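(* Let $1<p<\infty$ and let $\Gamma$ be an uncountable set. Let $(\Pi_n)_{n=0}^\infty$ and $(\Delta_n)_{n=0}^\infty$ be admissible sequences of sets (with respect to $\Gamma$). Then $E(\Pi_n)$ and $E(\Delta_n)$ are isomorphic if and only if there exists $k\in\mathbb{N}$ such that $$|\Pi_n|\leq|\Delta_{n+k}|\leq|\Pi_{n+2k}|$$ for all $n\in\mathbb{N}\cup\{0\}$.
   Context: For a set $S$ and $w:S\to(0,\infty)$, $\ell^{p,\infty}(S,w)$ is the space of all $x:S\to\mathbb{R}$ with $\|x\|=\sup_{c>0}c\,(\mu\{|x|>c\})^{1/p}<\infty$, where $\mu(A)=\sum_{s\in A}w(s)$ for $A\subseteq S$. This expression is equivalent to a norm under which the space is a Banach space. ''Isomorphic'' means linearly homeomorphic. $|A|$ denotes the cardinality of $A$; $\mathbb{N}=\{1,2,\ldots\}$. For a sequence $(\Gamma_n)_{n=0}^\infty$ of pairwise disjoint sets, $E(\Gamma_n)$ denotes $\ell^{p,\infty}(\bigcup_{n=0}^\infty\Gamma_n,w)$ with $w(\gamma)=2^n$ for $\gamma\in\Gamma_n$. A sequence $(\Pi_n)_{n=0}^\infty$ of pairwise disjoint sets is admissible (with respect to the fixed uncountable set $\Gamma$) if $|\Pi_n|\leq|\Pi_{n+1}|$ and $|\Pi_n|<\sup_m|\Pi_m|=|\Gamma|$ for all $n\geq0$. *)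

(* Defs.v *)
From HB Require Import structures.
From mathcomp Require Import all_boot all_order all_algebra.
From mathcomp Require Import all_classical all_reals all_analysis.

Set Implicit Arguments.
Unset Strict Implicit.
Unset Printing Implicit Defensive.

Import Order.TTheory GRing.Theory Num.Theory.
Import numFieldNormedType.Exports.

Local Open Scope classical_set_scope.
Local Open Scope ring_scope.

(* Weak l^p spaces l^{p,oo}(S, w); a choiceType index is no restriction, as  *)
(* every type has a choice structure classically.                            *)

Section weak_lp_norm.
Context {R : realType} {S : choiceType} (p : R) (w : S -> {posnum R}).
Local Open Scope ereal_scope.

Definition wmass (A : set S) : \bar R := \esum_(s in A) ((w s)%:num)%:E.

Definition wlp_norm (x : S -> R) : \bar R :=
  ereal_sup [set c%:E * (wmass [set s | (c < `|x s|)%R]) `^ p^-1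
            | c in [set c : R | (0 < c)%R]].

Lemma wmass_ge0 A : 0 <= wmass A.
Proof. exact: esum_ge0. Qed.

Lemma wmass0 : wmass set0 = 0.
Proof. exact: esum_set0. Qed.

Lemma le_wmass A B : A `<=` B -> wmass A <= wmass B.
Proof.
move=> AB; rewrite /wmass esum_mkcond [leRHS]esum_mkcond.
apply: le_esum => s _; case: ifPn => [/set_mem/AB/mem_set -> //|_].
by case: ifP.
Qed.

Lemma wmassU A B : wmass (A `|` B) <= wmass A + wmass B.
Proof.
rewrite /wmass esum_mkcond (esum_mkcond A) (esum_mkcond B) -esumD; last 2 first.
- by move=> s _; case: ifP.
- by move=> s _; case: ifP.
apply: le_esum => s _; rewrite in_setU.
by case: (s \in A); case: (s \in B) => /=; rewrite ?adde0 ?add0e ?leeDl.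
Qed.

Lemma wlp_norm_ub x c : (0 < c)%R ->
  c%:E * (wmass [set s | (c < `|x s|)%R]) `^ p^-1 <= wlp_norm x.
Proof. by move=> c0; apply: ereal_sup_ubound; exists c. Qed.

Lemma wlp_norm_ge0 x : 0 <= wlp_norm x.
Proof.
apply: le_trans (wlp_norm_ub x (@ltr01 R)).
by rewrite mule_ge0// poweR_ge0.
Qed.

Lemma wlp_normN x : wlp_norm (- x)%R = wlp_norm x.
Proof.
congr ereal_sup; apply: eq_imagel => c _.
by congr (_ * (wmass _ `^ _)); apply/funext => s /=; rewrite normrN.
Qed.

Lemma wlp_norm0 : (0 < p)%R -> wlp_norm 0%R = 0.
Proof.
move=> p0; apply/eqP; rewrite eq_le wlp_norm_ge0 andbT.
apply: ge_ereal_sup => _ [c c0 <-].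
rewrite (_ : [set _ | _] = set0) ?wmass0 ?poweR0r ?mule0 ?invr_eq0 ?gt_eqF//.
by apply/seteqP; split => s //=; rewrite normr0 ltNge (ltW c0).
Qed.

Lemma wlp_normZ (a : R) x : (0 < p)%R ->
  wlp_norm (a *: x)%R <= `|a|%:E * wlp_norm x.
Proof.
move=> p0; have [->|a0] := eqVneq a 0%R.
  by rewrite scale0r wlp_norm0// normr0 mul0e.
apply: ge_ereal_sup => _ [c c0 <-].
have na : (0 < `|a|)%R by rewrite normr_gt0.
have -> : [set s | (c < `|(a *: x) s|)%R] =
          [set s | (c / `|a| < `|x s|)%R].
  apply/funext => s /=.
  by rewrite normrM ltr_pdivrMr// [in RHS]mulrC.
rewrite [X in X%:E * _](_ : c = `|a| * (c / `|a|))%R; last first.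
  by rewrite mulrC divfK// gt_eqF.
rewrite EFinM -muleA.
by rewrite lee_pmul2l//= wlp_norm_ub// divr_gt0.
Qed.

(* Quasi-triangle inequality *)
Lemma wlp_normD x y (M : \bar R) : (1 < p)%R ->
  wlp_norm x <= M -> wlp_norm y <= M -> wlp_norm (x + y)%R <= 4%:E * M.
Proof.
move=> p1 xM yM; have p0 : (0 < p)%R by apply: lt_trans p1.
apply: ge_ereal_sup => _ [c c0 <-].
have c20 : (0 < c / 2)%R by rewrite divr_gt0.
pose A (z : S -> R) := [set s | (c / 2 < `|z s|)%R].
have hA z : wlp_norm z <= M -> (c / 2)%:E * wmass (A z) `^ p^-1 <= M.
  by apply: le_trans; exact: wlp_norm_ub.
have leU : wmass [set s | (c < `|(x + y)%R s|)%R] <= wmass (A x) + wmass (A y).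
  apply: le_trans (wmassU _ _); apply: le_wmass => s /= h.
  rewrite /A /=; apply/orP; rewrite !ltNge -negb_and; apply/negP => /andP[hx hy].
  move: h; rewrite ltNge => /negP; apply.
  by rewrite (le_trans (ler_normD _ _))// (splitr c) lerD.
have pI0 : (0 <= p^-1)%R by rewrite invr_ge0 ltW.
have le2 B : wmass [set s | (c < `|(x + y)%R s|)%R] <= 2%:E * wmass B ->
    (c / 2)%:E * wmass B `^ p^-1 <= M ->
    c%:E * wmass [set s | (c < `|(x + y)%R s|)%R] `^ p^-1 <= 4%:E * M.
  move=> le2B leM.
  have le2' : wmass [set s | (c < `|(x + y)%R s|)%R] `^ p^-1
      <= 2%:E * wmass B `^ p^-1.
    apply: (@le_trans _ _ ((2%:E * wmass B) `^ p^-1)).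
      apply: gt0_ler_poweR => //; rewrite in_itv/= ?leey ?andbT ?wmass_ge0//.
      by rewrite mule_ge0// wmass_ge0.
    rewrite poweRM ?wmass_ge0// lee_wpmul2r ?poweR_ge0//.
    rewrite poweR_EFin lee_fin -[leRHS]powRr1// ler_powR ?ler1n//.
    by rewrite invf_le1// ltW.
  apply: (@le_trans _ _ (c%:E * (2%:E * wmass B `^ p^-1))).
    by rewrite lee_pmul2l.
  have -> : c%:E * (2%:E * wmass B `^ p^-1) =
            4%:E * ((c / 2)%:E * wmass B `^ p^-1).
    rewrite !muleA -!EFinM; congr (_%:E * _).
    have -> : (4 = 2 * 2 :> R)%R by rewrite -natrM.
    by rewrite -mulrA (mulrCA 2%R c) divff// mulr1 mulrC.
  by rewrite lee_pmul2l.
have [le_xy|/ltW le_yx] := leP (wmass (A x)) (wmass (A y)).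
- apply: (le2 (A y)); last exact: hA.
  by rewrite (le_trans leU)// mule_natl mule2n leeD2r.
- apply: (le2 (A x)); last exact: hA.
  by rewrite (le_trans leU)// mule_natl mule2n leeD2l.
Qed.

End weak_lp_norm.

Section weak_lp.
Context {R : realType} {S : choiceType} (p : R) (w : S -> {posnum R}).

Definition wlp_pred : {pred S -> R} :=
  mem [set x : S -> R | (wlp_norm p w x < +oo)%E].

(* The hypothesis 1 < p makes wlp_pred a subspace; it is a parameter of the  *)
(* type because the algebraic and topological instances below depend on it.  *)
Record weak_lp (p1 : 1 < p) := WeakLp {
  weak_lp_val :> S -> R;
  _ : weak_lp_val \in wlp_pred }.

Context (p1 : 1 < p).

HB.instance Definition _ := [isSub for @weak_lp_val p1].
HB.instance Definition _ := [Choice of weak_lp p1 by <:].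

Lemma wlp_submod_closed : submod_closed wlp_pred.
Proof.
have p0 : 0 < p by apply: lt_trans p1.
split; first by rewrite inE /= wlp_norm0.
move=> a x y; rewrite !inE /= => xoo yoo.
have axoo : (wlp_norm p w (a *: x) < +oo)%E.
  by rewrite (le_lt_trans (wlp_normZ _ _ _ p0))// lte_mul_pinfty.
apply: (@le_lt_trans _ _
  (4%:E * (wlp_norm p w (a *: x) + wlp_norm p w y))%E).
  by apply: wlp_normD => //; rewrite ?leeDl ?leeDr ?wlp_norm_ge0.
by rewrite lte_mul_pinfty// lte_add_pinfty.
Qed.

HB.instance Definition _ :=
  GRing.isSubmodClosed.Build R (S -> R) wlp_pred wlp_submod_closed.
HB.instance Definition _ := [SubChoice_isSubLmodule of weak_lp p1 by <:].

(* The quasi-norm induces the uniform structure generated by the sets        *)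
(* {(x, y) | ||x - y|| < e}, e > 0; it yields the topology in which these    *)
(* sections are a neighborhood basis at each point.                          *)
Definition weak_lp_ent : set_system (weak_lp p1 * weak_lp p1) :=
  filter_from [set e : R | 0 < e]
    (fun e => [set xy | (wlp_norm p w (val xy.1 - val xy.2)%R < e%:E)%E]).

Lemma weak_lp_ent_filter : Filter weak_lp_ent.
Proof.
apply: filter_from_filter; first by exists 1 => /=.
move=> a b /= a0 b0; exists (Num.min a b); first by rewrite /= lt_min a0.
move=> xy /= h; split; apply: (lt_le_trans h); rewrite lee_fin ge_min lexx//.
by rewrite orbT.
Qed.

Lemma weak_lp_ent_diagonal A : weak_lp_ent A -> diagonal `<=` A.
Proof.
move=> [e /= e0 eA] [x y] /= /diagonalP ->; apply: eA => /=.
by rewrite subrr wlp_norm0// (lt_trans _ p1).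
Qed.

Local Open Scope relation_scope.

Lemma weak_lp_ent_inv A : weak_lp_ent A -> weak_lp_ent A^-1.
Proof.
move=> [e /= e0 eA]; exists e => // -[x y] /= h; apply: eA => /=.
by rewrite -opprB wlp_normN.
Qed.

Lemma weak_lp_ent_split_ex A : weak_lp_ent A ->
  exists2 B, weak_lp_ent B & B \; B `<=` A.
Proof.
move=> [e /= e0 eA].
exists [set xy | (wlp_norm p w (val xy.1 - val xy.2)%R < (e / 8)%:E)%E].
  by exists (e / 8) => //=; rewrite divr_gt0.
move=> [x z] /= [y /= /ltW xy /ltW yz]; apply: eA => /=.
have -> : (x : S -> R) - (z : S -> R) = (x - y : S -> R) + (y - z : S -> R).
  by rewrite addrA subrK.
rewrite (le_lt_trans (wlp_normD p1 xy yz))// -EFinM lte_fin.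
rewrite mulrCA gtr_pMr// ltr_pdivrMr// mul1r ltr_nat//.
Qed.

Local Close Scope relation_scope.

HB.instance Definition _ := isUniform.Build (weak_lp p1)
  weak_lp_ent_filter weak_lp_ent_diagonal weak_lp_ent_inv
  weak_lp_ent_split_ex.

End weak_lp.

Definition isomorphic (R : realType) (E F : preTopologicalLmodType R) : Prop :=
  exists (f : {linear E -> F}) (g : F -> E),
    [/\ cancel f g, cancel g f, continuous f & continuous g].

(* The weight 2 ^ n on Gam n; the index n is unique when the Gam n are       *)
(* pairwise disjoint.                                                        *)
Definition dyadic_weight (R : realType) (T : choiceType) (Gam : nat -> set T)
    (s : set_type (\bigcup_n Gam n)) : {posnum R} :=
  (2 ^+ xget 0%N [set n | Gam n (val s)])%:pos.

Definition E_space (R : realType) (p : R) (p1 : 1 < p) (T : choiceType)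
    (Gam : nat -> set T) : preTopologicalLmodType R :=
  weak_lp (@dyadic_weight R T Gam) p1.

Local Open Scope card_scope.

(* sup_m |Gam m| = |G|: the cardinal of G is the least upper bound of the    *)
(* cardinals of the Gam m.                                                   *)
Definition is_card_sup (T U : Type) (Gam : nat -> set T) (G : set U) : Prop :=
  (forall m, Gam m #<= G) /\
  (forall (V : Type) (B : set V), (forall m, Gam m #<= B) -> G #<= B).

Definition card_lt (T U : Type) (A : set T) (B : set U) : Prop :=
  A #<= B /\ ~ (B #<= A).

Definition admissible (T U : Type) (G : set U) (Pi : nat -> set T) : Prop :=
  [/\ trivIset setT Pi,
      forall n, Pi n #<= Pi n.+1,
      forall n, card_lt (Pi n) G
    & is_card_sup Pi G].

(* Main.v *)
Require Import Defs.
From HB Require Import structures.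
From mathcomp Require Import all_boot all_order all_algebra.
From mathcomp Require Import all_classical all_reals all_analysis.
From mathcomp Require Import ring lra zify.

Set Implicit Arguments.
Unset Strict Implicit.
Unset Printing Implicit Defensive.

Import Order.TTheory GRing.Theory Num.Theory.
Import numFieldNormedType.Exports.

Local Open Scope classical_set_scope.
Local Open Scope ring_scope.
Local Open Scope card_scope.

(** Cardinal bounds give an isomorphism by rearranging coordinates.  Injecting
    Pi_n into Delta_(n+k) changes weights by the factor 2^k.  In the other
    direction Delta_n goes into Pi_(n+k) for large n, and the finitely many low
    levels of Delta, whose union is no larger than a single infinite level,
    are sent together into one level of Pi.  The two injections distort weights
    by a bounded factor, hence so does the Cantor-Bernstein bijection built
    from them, each value of which comes from one of the two
    ([Cantor_Bernstein_graph]).  Composition with it is the isomorphism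
    ([isomorphic_reindex]).

    Conversely let T be an isomorphism.  The heart is [countable_high_images]:
    for some H, only countably many atoms s of a given mass v have T(e_s)
    supported by atoms of mass at least H v.  Otherwise, T e_s having norm
    comparable to v^(1/p), uncountably many such s share a height t, with t^p
    of order at most 1/H, above which |T e_s| lives on a set of mass at least
    kappa v / t^p ([charged_subset]).  Any coordinate of the target is reached
    by countably many e_s only ([coordinate_countable]), so disjoint images can
    be chosen.  As H is arbitrary, t can be made as small as desired, and one
    stacks r blocks: at height t_i take (1/t_i) times a sum of about
    L t_i^p / v_i unit vectors with disjoint images.  If the t_i decrease
    geometrically, the blocks live at geometrically separated heights and the
    norm of their sum to the power p is at most 4L, whatever r is.  But all
    the images exceed 1 on disjoint sets of mass at least kappa L, so that
    the image of the sum has norm to the power p at least r kappa L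
    ([stacked_blocks]): absurd for large r.

    Now let 2^k >= H with Delta_k infinite.  All but countably many atoms of
    Pi_n have an image touching some Delta_m with m <= n + k, and each of these
    coordinates is touched by countably many of them.  Hence
    |Pi_n| <= |Delta_(n+k)|, an infinite set absorbing countable fibres
    ([card_le_bigcup_countable]).  This and the symmetric statement give a
    common k, as the levels increase. *)

(** * Cardinals *)

Lemma card_le_set_inj (T U : Type) (A : set T) (B : set U) (f : T -> U) :
  set_fun A B f -> set_inj A f -> A #<= B.
Proof.
move=> fAB finj; suff /injfunPex[g] : exists2 f : T -> U,
  set_fun A B f & set_inj A f by exact: inj_card_le g.
by exists f.
Qed.

Lemma card_le_set_injP (T U : Type) (A : set T) (B : set U) :
  A #<= B -> A !=set0 -> exists2 f : T -> U, set_fun A B f & set_inj A f.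
Proof.
move=> AB [a Aa].
have [b Bb] : B !=set0.
  apply/set0P/eqP => B0; move: AB; rewrite B0 => /card_le0P A0.
  by rewrite A0 in Aa.
elim/Ppointed: U => U in B AB b Bb *; first by case: (no b).
by move: AB => /pcard_leP/injfunPex.
Qed.

Lemma countableU (T : Type) (A B : set T) :
  countable A -> countable B -> countable (A `|` B).
Proof.
move=> cA cB; rewrite -bigcup2E; apply: bigcup_countable => // -[|[|k]] _ //=.
Qed.

(** Countable fibres do not enlarge an infinite set.  By Zorn's lemma K is, up
    to a finite set, a disjoint union of ranges of injective sequences; the
    countably many points of X lying over one sequence are listed along it. *)
Lemma card_le_bigcup_countable (T V : Type) (K : set T) (F : T -> set V)
    (X : set V) : infinite_set K -> (forall i, K i -> countable (F i)) ->
  X `<=` \bigcup_(i in K) F i -> X #<= K.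
Proof.
move=> infK cF XF.
pose P := [set s : nat -> T | injective s /\ range s `<=` K].
have [M [MP Mtriv Mmax]] := @ex_maximal_disjoint_subcollection _ _
  (fun s : nat -> T => range s) P.
pose J := \bigcup_(s in M) range s.
(* an infinite remainder would contain one more sequence *)
have finR : finite_set (K `\` J).
  apply: contrapT => /infiniteP /card_le_set_injP [|g gR ginj]; first by exists 0%N.
  have MNg : ~ M g.
    by move=> Mg; case: (gR 0%N I) => _; apply; exists g => //; exists 0%N.
  apply: (Mmax (M `|` [set g])).
  - by split; [move=> s; left | move=> /(_ g (or_intror erefl))].
  - move=> s [/MP//|->]; split; first by move=> i j; apply: ginj; rewrite inE.
    by move=> _ [i _ <-]; case: (gR i I).
  - move=> s t [Ms|->] [Mt|->] //; first exact: Mtriv.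
    + move=> [x [sx [i _ gix]]].
      by case: (gR i I) => _ []; exists s => //; rewrite gix.
    + move=> [x [[i _ gix] sx]].
      by case: (gR i I) => _ []; exists t => //; rewrite gix.
have [s0 Ms0] : M !=set0.
  apply/set0P/eqP => M0; apply: infK; apply: sub_finite_set finR => i Ki; split=> //.
  by case=> s; rewrite M0.
(* every fibre also receives the finite remainder, which may sit anywhere *)
pose G (s : nat -> T) := (\bigcup_(j in range s) F j) `|` \bigcup_(i in K `\` J) F i.
have cG s : M s -> countable (G s).
  move=> /MP[_ sK]; apply: countableU.
    apply: bigcup_countable => [|j /sK/cF//].
    exact: card_le_trans (card_image_le _ _) (card_lexx _).
  apply: bigcup_countable => [|j [/cF//]]; exact: finite_set_countable.
have /choice[sel selP] : forall x, exists s, X x -> M s /\ G s x.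
  move=> x; have [Xx|nXx] := pselect (X x); last by exists s0.
  have [i Ki Fix] := XF _ Xx; have [[s Ms si]|nJi] := pselect (J i).
    by exists s => _; split=> //; left; exists i.
  by exists s0 => _; split=> //; right; exists i.
have /choice[e eP] : forall s, exists e : V -> nat, M s -> {in G s &, injective e}.
  move=> s; have [Ms|nMs] := pselect (M s); last by exists (fun=> 0%N).
  by have /countable_injP[e einj] := cG _ Ms; exists e.
apply: (@card_le_set_inj _ _ _ _ (fun x => sel x (e (sel x) x))).
  by move=> x /selP[/MP[_ sK] _]; apply: sK; exists (e (sel x) x).
move=> x y /set_mem Xx /set_mem Xy /= exy.
have [Mx Gx] := selP _ Xx; have [My Gy] := selP _ Xy.
have sxy : sel x = sel y.
  apply: Mtriv => //; exists (sel x (e (sel x) x)); split; first by eexists.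
  by rewrite exy; eexists.
rewrite sxy in exy Gx; apply: (eP _ My); rewrite ?inE//.
by have /MP[sinj _] := My; apply: sinj; rewrite -exy.
Qed.

Section cardinals_of_levels.
Context {T X : Type} (Gam : nat -> set T) (G : set X).

Lemma card_le_homo : (forall n, Gam n #<= Gam n.+1) ->
  forall m n, (m <= n)%N -> Gam m #<= Gam n.
Proof.
move=> mono m n; elim: n => [|n IH]; first by rewrite leqn0 => /eqP ->.
rewrite leq_eqVlt => /orP[/eqP -> //|]; rewrite ltnS => /IH/card_le_trans; exact.
Qed.

Lemma exists_infinite_level : ~ countable G -> is_card_sup Gam G ->
  exists m, infinite_set (Gam m).
Proof.
move=> ncG [_ supG]; apply: contrapT => /forallNP fin; apply: ncG; apply: supG => m.
by apply: finite_set_countable; apply: contrapT; exact: fin.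
Qed.

(** Injecting the lower levels into the level M, each point of the latter has
    at most one preimage in each of them. *)
Lemma card_le_bigcup_levels M : (forall n, Gam n #<= Gam n.+1) ->
  infinite_set (Gam M) -> \bigcup_(m in [set m | (m <= M)%N]) Gam m #<= Gam M.
Proof.
move=> mono infM; have hom := card_le_homo mono.
have /choice[f fP] : forall m, exists f : T -> T, (m <= M)%N ->
    set_fun (Gam m) (Gam M) f /\ set_inj (Gam m) f.
  move=> m; have [->|/set0P G0] := eqVneq (Gam m) set0.
    by exists id => _; split=> // x y /set_mem.
  have [mM|] := leqP m M; last by exists id.
  by have [f fun_f inj_f] := card_le_set_injP (hom _ _ mM) G0; exists f.
pose F y := \bigcup_(m in [set m | (m <= M)%N]) [set x | Gam m x /\ f m x = y].
apply: (@card_le_bigcup_countable _ _ _ F) => // [y _|x [m mM mx]].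
  apply: bigcup_countable => // m mM; apply/countable_injP; exists (fun=> 0%N).
  move=> x x' /set_mem[mx fx] /set_mem[mx' fx'] _.
  by apply: (fP _ mM).2; rewrite ?inE// fx fx'.
by exists (f m x); [exact: (fP _ mM).1|exists m].
Qed.
End cardinals_of_levels.

(** Injections between levels glue together because distinct levels of the
    source are sent to distinct, hence disjoint, levels of the target. *)
Lemma level_injection (T U : Type) (Gam : nat -> set T) (Lam : nat -> set U)
    (h : nat -> nat) (A : set T) : A `<=` \bigcup_n Gam n -> inhabited U ->
  injective h -> trivIset setT Lam ->
  (forall n, Gam n #<= Lam (h n)) ->
  exists2 f : set_type A -> set_type (\bigcup_n Lam n), injective f &
    forall s, exists n, Gam n (val s) /\ Lam (h n) (val (f s)).
Proof.
move=> AG [u0] hinj tL le.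
have /choice[f fP] : forall n, exists f : T -> U,
    set_fun (Gam n) (Lam (h n)) f /\ set_inj (Gam n) f.
  move=> n; have [->|/set0P G0] := eqVneq (Gam n) set0.
    by exists (fun=> u0); split=> // x y /set_mem.
  by have [f fun_f inj_f] := card_le_set_injP (le n) G0; exists f.
have /choice[F FP] : forall s : set_type A,
    exists u : set_type (\bigcup_n Lam n),
      exists n, Gam n (val s) /\ val u = f n (val s).
  move=> s; have [n _ ns] := AG _ (set_valP s).
  have Lfs : (\bigcup_n Lam n) (f n (val s)) by exists (h n) => //; exact: (fP n).1.
  by exists (SigSub (mem_set Lfs)), n.
exists F => [s s' FF|s].
  have [n [ns es]] := FP s; have [n' [ns' es']] := FP s'.
  have nn : n = n'.
    apply/hinj/(tL _ _ I I); exists (val (F s)); split.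
      by rewrite es; exact: (fP n).1.
    by rewrite FF es'; exact: (fP n').1.
  subst n'; apply: val_inj; apply: (fP n).2; rewrite ?inE// -es -es' FF//.
by have [n [ns es]] := FP s; exists n; rewrite es; split=> //; exact: (fP n).1.
Qed.

(** The bijection is made of pieces of f and of the inverse of g, so that it
    inherits any bound that holds along both graphs.  It is f on the points
    obtained by iterating g o f from outside the range of g. *)
Lemma Cantor_Bernstein_graph (A B : Type) (f : A -> B) (g : B -> A) :
  injective f -> injective g ->
  exists (h : A -> B) (h' : B -> A), [/\ cancel h h', cancel h' h &
    forall a, h a = f a \/ g (h a) = a].
Proof.
move=> finj ginj.
pose C a := exists n a0, (forall b, g b <> a0) /\ a = iter n (g \o f) a0.
have /choice[h hP] : forall a, exists b, (C a -> b = f a) /\ (~ C a -> g b = a).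
  move=> a; have [Ca|nCa] := pselect (C a); first by exists (f a).
  have [b gba] : exists b, g b = a.
    by apply: contrapT => /forallNP nb; apply: nCa; exists 0%N, a.
  by exists b.
have Cgf a : C a -> C (g (f a)).
  by move=> [n [a0 [na0 ->]]]; exists n.+1, a0.
have hinj : injective h.
  move=> a a' haa; have [Ca|nCa] := pselect (C a); have [Ca'|nCa'] := pselect (C a').
  - by apply: finj; rewrite -(hP a).1// -(hP a').1.
  - case: (nCa'); have := (hP a').2 nCa'.
    by rewrite -haa (hP a).1// => <-; exact: Cgf.
  - case: (nCa); have := (hP a).2 nCa.
    by rewrite haa (hP a').1// => <-; exact: Cgf.
  - by have := (hP a).2 nCa; rewrite haa (hP a').2.
have hsurj b : exists a, h a = b.
  have [|nC] := pselect (C (g b)); last by exists (g b); apply: ginj; exact: (hP _).2.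
  move=> [[|n] [a0 [na0 /= gb]]]; first by case: (na0 b).
  exists (iter n (g \o f) a0); rewrite (hP _).1; last by exists n, a0.
  by apply: ginj.
have /choice[h' hh'] := hsurj.
exists h, h'; split=> // [a|a]; first exact/hinj/hh'.
have [Ca|nCa] := pselect (C a); [left|right]; [exact: (hP _).1|exact: (hP _).2].
Qed.

(** * Weak bounds *)

Lemma powRV (R : realType) (a p : R) : 0 <= a -> a^-1 `^ p = (a `^ p)^-1.
Proof. by move=> a0; rewrite -powRN -mulN1r powRrM powR_inv1. Qed.

Section weak_bound.
Context {R : realType} {S : choiceType} (p : R) (w : S -> {posnum R}).
Implicit Types (x y : S -> R) (K t : R) (A B : set S).

(** This says that the norm of x to the power p is at most K; stated without
    p-th roots, it combines well with the additivity of masses. *)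
Definition weak_bound K x := forall t, 0 < t ->
  (wmass w [set s | (t < `|x s|)%R] <= (K / t `^ p)%:E)%E.

Lemma wlp_norm_weak_bound x (a : R) : 0 < p -> 0 <= a ->
  (wlp_norm p w x <= a%:E)%E <-> weak_bound (a `^ p) x.
Proof.
move=> p0 a0.
have key (m : \bar R) t : 0 < t -> (0 <= m)%E ->
    (t%:E * m `^ p^-1 <= a%:E <-> m <= (a `^ p / t `^ p)%:E)%E.
  move=> t0; have pI0 : p^-1 != 0 by rewrite invr_eq0 gt_eqF.
  have at0 : 0 <= a / t by rewrite divr_ge0// ltW.
  have -> : a `^ p / t `^ p = (a / t) `^ p.
    by rewrite powRM ?invr_ge0 ?(ltW t0)// powRV// ltW.
  case: m => [r| |] //; last first.
    by rewrite poweRyr// gt0_muley ?lte_fin// !leye_eq.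
  rewrite lee_fin => r0; rewrite poweR_EFin -EFinM !lee_fin mulrC -ler_pdivlMr//.
  split=> h.
  - have := ge0_ler_powR (ltW p0) _ _ h; rewrite /=.
    rewrite -powRrM mulVf ?gt_eqF// powRr1//; apply; rewrite nnegrE ?powR_ge0//.
  - have pI : 0 <= p^-1 by rewrite invr_ge0 ltW.
    have := ge0_ler_powR pI _ _ h; rewrite /=.
    rewrite -powRrM mulfV ?gt_eqF// powRr1//; apply; rewrite nnegrE ?powR_ge0//.
split=> [xa t t0|xa].
  apply/key => //; first exact: wmass_ge0.
  by apply: le_trans xa; exact: wlp_norm_ub.
by apply: ge_ereal_sup => _ [t t0 <-]; apply/key; [exact: t0|exact: wmass_ge0|exact: xa].
Qed.

Lemma wmass1 s : wmass w [set s] = (w s)%:num%:E.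
Proof. by rewrite /wmass esum_set1. Qed.

Lemma wmass_disjointU A B : A `&` B = set0 ->
  wmass w (A `|` B) = (wmass w A + wmass w B)%E.
Proof.
move=> AB0; rewrite /wmass esum_mkcond (esum_mkcond A) (esum_mkcond B) -esumD; last 2 first.
- by move=> s _; case: ifP.
- by move=> s _; case: ifP.
apply: eq_esum => s _; rewrite in_setU.
have [/set_mem As|] := boolP (s \in A); have [/set_mem Bs|] := boolP (s \in B) => //=;
  rewrite ?adde0 ?add0e//.
by have : (A `&` B) s by []; rewrite AB0.
Qed.

Lemma weak_boundZ K x (a : R) : 0 < a -> weak_bound K x ->
  weak_bound (a `^ p * K) (a *: x).
Proof.
move=> a0 xK t t0; have := xK (t / a) (divr_gt0 t0 a0).
have -> : [set s | t < `|(a *: x) s|] = [set s | t / a < `|x s|].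
  by apply/funext => s /=; rewrite normrM (gtr0_norm a0) ltr_pdivrMr// [in RHS]mulrC.
suff -> : a `^ p * K / t `^ p = K / (t / a) `^ p by [].
by rewrite powRM ?invr_ge0 ?ltW// powRV ?ltW// invfM invrK; ring.
Qed.

Lemma weak_bound_bounded x (M m : R) : 0 < p -> 0 <= m -> 0 <= M ->
  (forall s, `|x s| <= M) -> (wmass w [set s | (x s != 0)%R] <= m%:E)%E ->
  weak_bound (m * M `^ p) x.
Proof.
move=> p0 m0 M0 xM xm t t0; have [Mt|tM] := leP M t.
  rewrite (_ : [set _ | _] = set0) ?wmass0; last first.
    by apply/seteqP; split=> s //=; rewrite ltNge (le_trans (xM s)).
  by rewrite lee_fin mulr_ge0 ?invr_ge0 ?powR_ge0// mulr_ge0// powR_ge0.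
apply: le_trans (le_trans xm _).
  by apply: le_wmass => s /= h; rewrite -normr_gt0 (lt_trans t0).
rewrite lee_fin -mulrA ler_peMr// ler_pdivlMr ?powR_gt0// mul1r.
by apply: ge0_ler_powR; rewrite ?nnegrE// ltW.
Qed.

Lemma finite_wmass (A : set S) (m : R) : (forall s, 1 <= (w s)%:num) ->
  (wmass w A <= m%:E)%E -> finite_set A.
Proof.
move=> w1 Am; apply: contrapT => /(infinite_set_fset (Num.trunc m).+1)[X XA Xn].
have := le_trans (le_wmass w XA) Am.
rewrite /wmass esum_fset//; rewrite fsbig_finite//= set_fsetK.
apply/negP; rewrite -ltNge.
rewrite sumEFin lte_fin.
apply: (@lt_le_trans _ _ (\sum_(i <- finmap.enum_fset X) 1)); last exact: ler_sum.
rewrite big_const_seq count_predT iter_addr_0.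
apply: (@lt_le_trans _ _ (Num.trunc m).+1%:R); first by rewrite truncnS_gt.
by rewrite ler_nat.
Qed.

(** With atoms of mass at least 1, each superlevel set is finite. *)
Lemma weak_bound_countable K x : (forall s, 1 <= (w s)%:num) ->
  weak_bound K x -> countable [set s | x s != 0].
Proof.
move=> w1 xK.
apply: (@sub_countable _ _ _ (\bigcup_(n : nat) [set s | n.+1%:R^-1 < `|x s|])); last first.
  apply: bigcup_countable => // n _; apply: finite_set_countable.
  by apply: (finite_wmass w1); apply: xK; rewrite invr_gt0.
apply: subset_card_le => s /= xs0; have x0 : 0 < `|x s| by rewrite normr_gt0.
exists (Num.trunc `|x s|^-1) => //=.
by rewrite invf_plt ?posrE// truncnS_gt.
Qed.
End weak_bound.

Section disjoint_supports.
Context {R : realType} {S : choiceType} (w : S -> {posnum R}).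
Implicit Types x y : S -> R.

Definition disjoint_supp x y := forall s, x s = 0 \/ y s = 0.

Lemma wmass_suppD x y (m n : R) :
  (wmass w [set s | x s != 0%R] <= m%:E)%E ->
  (wmass w [set s | y s != 0%R] <= n%:E)%E ->
  (wmass w [set s | (x s + y s != 0)%R] <= (m + n)%:E)%E.
Proof.
move=> xm yn; rewrite EFinD; apply: le_trans (leeD xm yn).
apply: le_trans (wmassU _ _ _); apply: le_wmass => s /= xy.
have [x0|] := eqVneq (x s) 0; last by left.
by right; apply: contraNneq xy => ->; rewrite x0 addr0.
Qed.

Lemma wmass_levelD x y (t m n : R) : 0 <= t -> disjoint_supp x y ->
  (m%:E <= wmass w [set s | (t < `|x s|)%R])%E ->
  (n%:E <= wmass w [set s | (t < `|y s|)%R])%E ->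
  ((m + n)%:E <= wmass w [set s | (t < `|x s + y s|)%R])%E.
Proof.
rewrite leNgt => /negbTE t0 xy xm yn; rewrite EFinD; apply: le_trans (leeD xm yn) _.
rewrite -wmass_disjointU; last first.
  by apply/seteqP; split=> s //= -[]; case: (xy s) => ->; rewrite normr0 t0.
by apply: le_wmass => s /=; case: (xy s) => ->; rewrite normr0 t0 ?add0r ?addr0 => -[].
Qed.

Lemma le_normD_disjoint x y (M : R) : disjoint_supp x y ->
  (forall s, `|x s| <= M) -> (forall s, `|y s| <= M) -> forall s, `|x s + y s| <= M.
Proof. by move=> xy xM yM s; case: (xy s) => ->; rewrite ?add0r ?addr0. Qed.
End disjoint_supports.

Section unit_vectors.
Context {R : realType} {S : choiceType} (p : R) (p1 : 1 < p)
  (w : S -> {posnum R}).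

Lemma weak_bound_pred K (x : S -> R) : 0 <= K -> weak_bound p w K x ->
  x \in wlp_pred p w.
Proof.
have p0 : 0 < p by apply: lt_trans p1.
move=> K0 xK; rewrite inE /=; apply: (@le_lt_trans _ _ (K `^ p^-1)%:E); last exact: ltry.
apply/wlp_norm_weak_bound; rewrite ?powR_ge0//.
by rewrite -powRrM mulVf ?gt_eqF// powRr1.
Qed.

Lemma weak_lp_weak_bound (x : weak_lp w p1) :
  exists2 K, 0 <= K & weak_bound p w K x.
Proof.
case: x => f fP /=; move: (fP); rewrite inE /= => fin.
exists (fine (wlp_norm p w f) `^ p); first exact: powR_ge0.
apply/wlp_norm_weak_bound; [exact: lt_trans p1|exact/fine_ge0/wlp_norm_ge0|].
by rewrite fineK// ge0_fin_numE// wlp_norm_ge0.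
Qed.

Lemma countable_supp (x : weak_lp w p1) : (forall s, 1 <= (w s)%:num) ->
  countable [set s | x s != 0].
Proof.
by move=> w_ge1; have [K _] := weak_lp_weak_bound x; exact: weak_bound_countable.
Qed.

Lemma wmass_supp_indic (s : S) :
  (wmass w [set t | ((t == s)%:R != 0 :> R)%R] <= (w s)%:num%:E)%E.
Proof.
rewrite -wmass1; apply: le_wmass => t /=.
by case: (eqVneq t s) => // _; rewrite eqxx.
Qed.

Lemma indic_wlp_pred (s : S) : (fun t => (t == s)%:R : R) \in wlp_pred p w.
Proof.
apply: (@weak_bound_pred ((w s)%:num * 1 `^ p)).
  by rewrite mulr_ge0// powR_ge0.
apply: weak_bound_bounded => //; first by apply: lt_trans p1.
- by move=> t; case: eqP => _; rewrite ?normr1 ?normr0.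
- exact: wmass_supp_indic.
Qed.

Definition unit_vec (s : S) : weak_lp w p1 := WeakLp p1 (indic_wlp_pred s).

Lemma weak_bound_unit_vec (s : S) : weak_bound p w (w s)%:num (unit_vec s).
Proof.
have -> : (w s)%:num = (w s)%:num * 1 `^ p by rewrite powR1 mulr1.
apply: weak_bound_bounded => //; first by apply: lt_trans p1.
- by move=> t /=; case: eqP => _; rewrite ?normr1 ?normr0.
- exact: wmass_supp_indic.
Qed.

(** The mass of {|e_s| > t} is w s for every t < 1; taking t^p = 3/4 already
    gives the constant 1/2, without passing to the limit. *)
Lemma weak_bound_unit_vec_ge (s : S) K : weak_bound p w K (unit_vec s) ->
  ((w s)%:num : R) / 2 < K.
Proof.
have p0 : 0 < p by apply: lt_trans p1.
have q0 : 0 < 3 / 4 :> R by rewrite divr_gt0.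
have tp : ((3 / 4 : R) `^ p^-1) `^ p = 3 / 4.
  by rewrite -powRrM mulVf ?gt_eqF// powRr1// ltW.
move=> /(_ _ (powR_gt0 p^-1 q0)); rewrite tp => h.
have aux (u k : R) : u * (3 / 4) <= k -> 0 < u -> u / 2 < k by move=> *; lra.
suff /le_trans/(_ h) : ((w s)%:num%:E <=
    wmass w [set t | ((3 / 4) `^ p^-1 < `|unit_vec s t|)%R])%E.
  rewrite lee_fin ler_pdivlMr// => /aux; apply; exact: gt0.
rewrite -wmass1; apply: le_wmass => t -> /=.
rewrite eqxx normr1.
have q1 : 3 / 4 < 1 :> R by rewrite ltr_pdivrMr// mul1r ltr_nat.
have pI0 : 0 < p^-1 by rewrite invr_gt0.
have := gt0_ltr_powR pI0 _ _ q1; rewrite powR1; apply; rewrite nnegrE ?ler01//.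
Qed.
End unit_vectors.

(** * Bounded operators *)

Section bounded_operators.
Context {R : realType} {S S' : choiceType} (p : R) (p1 : 1 < p)
  (w : S -> {posnum R}) (w' : S' -> {posnum R}).

Definition bounded_by (C : R) (T : weak_lp w p1 -> weak_lp w' p1) :=
  forall (x : weak_lp w p1) K, 0 < K -> weak_bound p w K x ->
    weak_bound p w' (C * K) (T x).

Lemma continuous_bounded (T : {linear weak_lp w p1 -> weak_lp w' p1}) :
  continuous T -> exists2 C, 0 < C & bounded_by C T.
Proof.
have p0 : 0 < p by apply: lt_trans p1.
move=> /(_ 0)/cvg_app_entourageP.
move=> /(_ [set xy | (wlp_norm p w' (val xy.1 - val xy.2)%R < 1%:E)%E]).
have ent1 : entourage [set xy : weak_lp w' p1 * weak_lp w' p1 |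
    (wlp_norm p w' (val xy.1 - val xy.2)%R < 1%:E)%E] by exists 1; first exact: ltr01.
move=> /(_ ent1)/nbhsP[E [e /= e0 eE] ET].
have Te (x : weak_lp w p1) : (wlp_norm p w x < e%:E)%E -> (wlp_norm p w' (T x) < 1)%E.
  move=> xe; rewrite -wlp_normN.
  have /ET/= : xsection E 0 x.
    by apply/xsectionP/eE => /=; rewrite sub0r wlp_normN.
  by rewrite linear0 sub0r.
have e20 : 0 < e / 2 by rewrite divr_gt0.
exists ((e / 2)^-1 `^ p); first by rewrite powR_gt0// invr_gt0.
move=> x K K0 xK; pose a := e / 2 / K `^ p^-1.
have a0 : 0 < a by rewrite divr_gt0// powR_gt0.
have apK : a `^ p * K = (e / 2) `^ p.
  rewrite /a powRM ?invr_ge0 ?powR_ge0 ?(ltW e20)// powRV ?powR_ge0//.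
  rewrite -powRrM mulVf ?gt_eqF// powRr1 ?(ltW K0)//.
  by rewrite mulfVK// gt_eqF.
have /ltW/(wlp_norm_weak_bound _ _ p0 ler01) : (wlp_norm p w' (T (a *: x)%R) < 1)%E.
  apply: Te; apply: (@le_lt_trans _ _ (e / 2)%:E).
    apply/wlp_norm_weak_bound => //; first exact: ltW.
    by rewrite -apK; exact: weak_boundZ.
  by rewrite lte_fin ltr_pdivrMr// ltr_pMr// ltr1n.
rewrite powR1 linearZ => /(weak_boundZ (a := a^-1)); rewrite invr_gt0 => /(_ a0).
rewrite scalerA mulVf ?gt_eqF// scale1r mulr1.
suff -> : (e / 2)^-1 `^ p * K = a^-1 `^ p by [].
by rewrite !powRV ?(ltW a0) ?(ltW e20)// -apK invfM mulfVK// gt_eqF.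
Qed.

Lemma bounded_continuous (T : {linear weak_lp w p1 -> weak_lp w' p1}) (C : R) :
  0 < C -> bounded_by C T -> continuous T.
Proof.
have p0 : 0 < p by apply: lt_trans p1.
move=> C0 TC x; apply/(@cvg_app_entourageP _ _ T (nbhs x) (nbhs_filter x)).
move=> A [e /= e0 eA].
have e20 : 0 < e / 2 by rewrite divr_gt0.
pose d := e / 2 / C `^ p^-1.
have d0 : 0 < d by rewrite divr_gt0// powR_gt0.
apply/nbhsP; exists [set xy | (wlp_norm p w (val xy.1 - val xy.2)%R < d%:E)%E].
  by exists d.
move=> y /xsectionP/= /ltW/(wlp_norm_weak_bound _ _ p0 (ltW d0)) xy.
apply: eA => /=; apply: (@le_lt_trans _ _ (e / 2)%:E); last first.
  by rewrite lte_fin ltr_pdivrMr// ltr_pMr// ltr1n.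
have := TC (x - y) _ (powR_gt0 _ d0) xy; rewrite linearB.
suff -> : C * d `^ p = (e / 2) `^ p by move/wlp_norm_weak_bound; apply=> //; exact: ltW.
rewrite /d powRM ?invr_ge0 ?powR_ge0 ?(ltW e20)// powRV ?powR_ge0//.
by rewrite -powRrM mulVf ?gt_eqF// powRr1 ?(ltW C0)// mulrC mulfVK// gt_eqF.
Qed.
End bounded_operators.

(** * Atoms with images on heavier atoms *)

Section embeddings.
Context {R : realType} {S S' : choiceType} (p : R) (p1 : 1 < p)
  (w : S -> {posnum R}) (w' : S' -> {posnum R})
  (w_ge1 : forall s, 1 <= (w s)%:num) (w'_ge1 : forall s, 1 <= (w' s)%:num)
  (T : {linear weak_lp w p1 -> weak_lp w' p1}) (C c : R)
  (C0 : 0 < C) (c0 : 0 < c) (TC : bounded_by C T)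
  (Tc : forall (x : weak_lp w p1) K, 0 < K ->
     weak_bound p w' K (T x) -> weak_bound p w (c * K) x).
Local Notation e := (unit_vec p1 w).

Let p0 : 0 < p. Proof. exact: lt_trans p1. Qed.

(** The witness is a signed sum of N unit vectors e_s, the signs making every
    contribution to the coordinate s' positive. *)
Lemma sign_sum_large (A : set S) (v eta : R) s' N : 0 <= v -> infinite_set A ->
  (forall s, A s -> (w s)%:num = v /\ eta < `|T (e s) s'|) ->
  exists x : weak_lp w p1, [/\ forall s, `|x s| <= 1,
    (wmass w [set s | (x s != 0)%R] <= (N%:R * v)%:E)%E & N%:R * eta <= T x s'].
Proof.
move=> v0 infA Aeta; elim: N => [|N [x [x1 xv xeta]]].
  exists 0; rewrite linear0 !mul0r; split=> // [s|]; first by rewrite normr0.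
  by rewrite (_ : [set _ | _] = set0) ?wmass0//; apply/seteqP; split=> s //=; rewrite eqxx.
have /infinite_setN0[s [As /negP]] := infinite_setD infA (finite_wmass w_ge1 xv).
rewrite negbK => /eqP xs0; have [ws es] := Aeta _ As.
pose a := Num.sg (T (e s) s'); exists (x + a *: e s).
have a1 : `|a| <= 1 by rewrite normr_sg; case: eqP.
split.
- apply: le_normD_disjoint x1 _ => t.
    have [->|/negbTE ts] := eqVneq t s; [by left|right].
    by rewrite -[LHS]/(a * (t == s)%:R) ts mulr0.
  rewrite -[_ t]/(a * (t == s)%:R) normrM mulr_ile1//=.
  by case: eqP => _; rewrite ?normr1 ?normr0.
- rewrite -natr1 mulrDl mul1r; apply: wmass_suppD xv _; rewrite -ws.
  apply: le_trans (wmass_supp_indic w s); apply: le_wmass => t /=.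
  by apply: contra => /eqP t0; rewrite -[_ t]/(a * (t == s)%:R) t0 mulr0.
- rewrite linearD linearZ -natr1 mulrDl mul1r lerD//=.
  by rewrite -[leRHS]/(Num.sg (T (e s) s') * T (e s) s') -normrEsg ltW.
Qed.

(** If infinitely many e_s of mass v had |T(e_s)(s')| > eta, the signed sum x of
    N of them would have norm at most (N v)^(1/p) and T(x)(s') >= N eta.
    Boundedness of T then bounds N^(p-1), which is where p > 1 enters. *)
Lemma coordinate_countable v s' : 0 < v ->
  countable [set s | (w s)%:num = v /\ T (e s) s' != 0].
Proof.
move=> v0.
apply: (@sub_countable _ _ _ (\bigcup_(n : nat)
    [set s | (w s)%:num = v /\ n.+1%:R^-1 < `|T (e s) s'|])); last first.
  apply: bigcup_countable => // n _; apply: finite_set_countable.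
  apply: contrapT => infA; set A := [set s | _] in infA.
  have [eta0 wv] : 0 < n.+1%:R^-1 :> R /\ 0 < (w' s')%:num :> R.
    by split; rewrite ?invr_gt0.
  move: (n.+1%:R^-1) eta0 @A infA => eta eta0 A infA.
  pose D := C * v / ((w' s')%:num * (eta / 2) `^ p).
  have D0 : 0 < D by rewrite /D divr_gt0 ?mulr_gt0 ?powR_gt0 ?divr_gt0.
  pose N := (Num.trunc (D `^ (p - 1)^-1)).+1.
  have ND : D `^ (p - 1)^-1 < N%:R by exact: truncnS_gt.
  have N0 : 0 < N%:R :> R by rewrite ltr0n.
  have [x [x1 xv xeta]] := @sign_sum_large A v eta s' N (ltW v0) infA (fun _ => id).
  have xK : weak_bound p w (N%:R * v) x.
    have -> : N%:R * v = N%:R * v * 1 `^ p by rewrite powR1 mulr1.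
    by apply: weak_bound_bounded => //; rewrite mulr_ge0// ltW.
  have t0 : 0 < N%:R * eta / 2 by rewrite !mulr_gt0// invr_gt0.
  have := TC (mulr_gt0 N0 v0) xK t0.
  apply/negP; rewrite -ltNge.
  apply: (@lt_le_trans _ _ (w' s')%:num%:E); last first.
    rewrite -wmass1; apply: le_wmass => _ -> /=.
    apply: lt_le_trans (ler_norm _); apply: lt_le_trans xeta.
    by rewrite ltr_pdivrMr// ltr_pMr ?mulr_gt0// ltr1n.
  rewrite lte_fin -(mulrA N%:R) powRM ?ltW ?divr_gt0//.
  rewrite ltr_pdivrMr ?mulr_gt0 ?powR_gt0 ?divr_gt0//.
  have Y0 : 0 < (w' s')%:num * (eta / 2) `^ p by rewrite mulr_gt0 ?powR_gt0 ?divr_gt0.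
  have CvD : C * v = D * ((w' s')%:num * (eta / 2) `^ p) by rewrite divfK// gt_eqF.
  rewrite mulrCA CvD [ltRHS]mulrCA.
  move: Y0; move: (_ * _ `^ p) => Y Y0; rewrite mulrA ltr_pM2r//.
  rewrite -mulr_powRB1 ?ltW// ltr_pM2l//.
  have p10 : 0 < p - 1 by rewrite subr_gt0.
  have := gt0_ltr_powR p10 _ _ ND; rewrite -powRrM mulVf ?gt_eqF// powRr1 ?ltW//.
  by apply; rewrite nnegrE ?powR_ge0// ltW.
apply: subset_card_le => s /= [ws es0]; have e0 : 0 < `|T (e s) s'| by rewrite normr_gt0.
exists (Num.trunc `|T (e s) s'|^-1) => //=; split=> //.
by rewrite invf_plt ?posrE// truncnS_gt.
Qed.

(** The images of the atoms of B share the height t: each of them exceeds t on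
    a mass of the order of the largest one, v / t^p, that boundedness allows. *)
Definition charged (kappa v t : R) (B : set S) :=
  [/\ ~ countable B, 0 < v, 0 < t, forall s, B s -> (w s)%:num = v &
    forall s, B s ->
      ((kappa * v / t `^ p)%:E <= wmass w' [set s' | (t < `|T (e s) s'|)%R])%E].

(** The factor 1 / (2 c) comes from the lower bound on T, the factor 2^(-p) from
    replacing a height u by a rational one in (u/2, u). *)
Definition height_const : R := (2 * c * 2 `^ p)^-1.

(** A lower bound on the norm of T(e_s) is witnessed at a single height.  It can
    be rational, so that only countably many heights occur. *)
Lemma exists_rational_height s : exists q : rat, 0 < ratr q :> R /\
  ((height_const * (w s)%:num / (ratr q) `^ p)%:E <=
     wmass w' [set s' | (ratr q < `|T (e s) s'|)%R])%E.
Proof.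
pose K : R := (w s)%:num / (2 * c).
have K0 : 0 < K by rewrite divr_gt0// mulr_gt0.
have /existsNP[u /not_implyP[u0 /negP]] : ~ weak_bound p w' K (T (e s)).
  move=> /(Tc K0)/weak_bound_unit_vec_ge.
  suff -> : c * K = (w s)%:num / 2 by rewrite ltxx.
  by rewrite /K invfM mulrCA (mulrCA c) divff ?gt_eqF// mulr1.
rewrite -ltNge => uK.
have uu : u / 2 < u by rewrite ltr_pdivrMr// ltr_pMr// ltr1n.
have [q] := rat_in_itvoo uu; rewrite in_itv/= => /andP[uq qu].
have q0 : 0 < ratr q :> R by apply: lt_trans uq; rewrite divr_gt0.
exists q; split=> //; apply: (@le_trans _ _ (K / u `^ p)%:E); last first.
  by apply: le_trans (ltW uK) _; apply: le_wmass => s' /=; exact: lt_trans.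
have q2 : 0 < 2 * ratr q :> R by exact: mulr_gt0.
have aux (W k P Q : R) : (2 * k * P)^-1 * W / Q = W / (2 * k) / (P * Q).
  by rewrite !invfM; ring.
rewrite lee_fin /height_const aux -powRM ?(ltW q0)// -/K.
rewrite ler_wpM2l ?(ltW K0)// lef_pV2 ?posrE ?powR_gt0//.
apply: ge0_ler_powR; rewrite ?nnegrE; [exact: ltW|exact: ltW|exact: ltW|].
by apply: ltW; rewrite mulrC -ltr_pdivrMr.
Qed.

(** By the pigeonhole principle uncountably many s in B have the same height t.
    The set where |T(e_s)| > t then contains an atom of mass at least H v, while
    its mass is at most C v / t^p: this forces t to be small. *)
Lemma charged_subset v H B : 0 < v -> 0 < H -> ~ countable B ->
  (forall s, B s -> (w s)%:num = v) ->
  (forall s s', B s -> T (e s) s' != 0 -> H * v <= (w' s')%:num) ->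
  exists t B', charged height_const v t B' /\ t `^ p <= C / H.
Proof.
move=> v0 H0 ncB wB HB; have /choice[sel selP] := exists_rational_height.
have [q ncq] : exists q, ~ countable [set s | B s /\ sel s = q].
  apply: contrapT => /forallNP h; apply: ncB.
  apply: (@sub_countable _ _ _ (\bigcup_(q : rat) [set s | B s /\ sel s = q])).
    by apply: subset_card_le => s Bs; exists (sel s).
  by apply: bigcup_countable => // q _; apply: contrapT; exact: h.
have [s [Bs sq]] : [set s | B s /\ sel s = q] !=set0.
  by apply/set0P/eqP => B0; apply: ncq; rewrite B0; exact: countable0.
have [h qh] : exists h : R, ratr q = h by exists (ratr q).
have [h0 hs] := selP s; rewrite sq qh in h0 hs.
have kap0 : 0 < height_const by rewrite invr_gt0 !mulr_gt0 ?powR_gt0.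
exists h, [set s | B s /\ sel s = q]; split.
  split=> // [t [/wB]//|t [Bt tq]]; rewrite -(wB _ Bt) -qh -tq; exact: (selP t).2.
have [s' hs'] : [set s' | h < `|T (e s) s'|] !=set0.
  apply/set0P/eqP => B0; move: hs; rewrite B0 wmass0 lee_fin leNgt.
  by rewrite divr_gt0 ?powR_gt0 ?mulr_gt0.
have Ts' : T (e s) s' != 0 by rewrite -normr_gt0 (lt_trans h0).
have /(TC v0)/(_ _ h0) : weak_bound p w v (e s).
  by rewrite -(wB _ Bs); exact: weak_bound_unit_vec.
move=> le2; have /le_trans/(_ le2) : (wmass w' [set s'] <=
    wmass w' [set s' | (h < `|T (e s) s'|)%R])%E.
  by apply: le_wmass => _ ->.
rewrite wmass1 lee_fin.
move/(le_trans (HB _ _ Bs Ts')).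
rewrite mulrAC ler_pM2r// !ler_pdivlMr ?powR_gt0//.
by rewrite mulrC.
Qed.

(** Each coordinate in D rules out only countably many s. *)
Lemma exists_disjoint_image B v (D0 : set S) (D : set S') : ~ countable B -> 0 < v ->
  (forall s, B s -> (w s)%:num = v) -> countable D0 -> countable D ->
  exists2 s, B s & ~ D0 s /\ forall s', D s' -> T (e s) s' = 0.
Proof.
move=> ncB v0 wB cD0 cD; apply: contrapT => h; apply: ncB.
apply: (@sub_countable _ _ _
  (D0 `|` \bigcup_(s' in D) [set s | (w s)%:num = v /\ T (e s) s' != 0])).
  apply: subset_card_le => s Bs; apply: contrapT => /not_orP[nD0 nD]; apply: h.
  exists s => //; split=> // s' Ds'; apply/eqP; apply: contrapT => /negP n0.
  by apply: nD; exists s' => //; split=> //; exact: wB.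
apply: countableU => //; apply: bigcup_countable => // s' _.
exact: coordinate_countable.
Qed.

(** A sum of N atoms of B with disjoint images, normalized so that its image
    exceeds 1.  The sets D0 and D to be avoided make blocks disjoint from one
    another, both before and after applying T. *)
Lemma homogeneous_block kappa v t B (D0 : set S) (D : set S') N : 0 < kappa ->
  charged kappa v t B -> countable D0 -> countable D ->
  exists x : weak_lp w p1, [/\ forall s, D0 s -> x s = 0,
    forall s, `|x s| <= t^-1,
    (wmass w [set s | (x s != 0)%R] <= (N%:R * v)%:E)%E,
    forall s', D s' -> T x s' = 0 &
    ((N%:R * (kappa * v / t `^ p))%:E <=
       wmass w' [set s' | (1 < `|T x s'|)%R])%E].
Proof.
move=> k0 [ncB v0 t0 wB TB] cD0 cD; elim: N => [|N [x [xD0 xt xv TxD Txm]]].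
  exists 0; rewrite linear0 !mul0r; split=> // [s| |].
  - by rewrite normr0 invr_ge0 ltW.
  - rewrite (_ : [set _ | _] = set0) ?wmass0//.
    by apply/seteqP; split=> s //=; rewrite eqxx.
  - exact: wmass_ge0.
have [s Bs [/not_orP[sD0 /negP]]] := exists_disjoint_image ncB v0 wB
  (countableU cD0 (countable_supp x w_ge1)) (countableU cD (countable_supp (T x) w'_ge1)).
rewrite negbK => /eqP xs0 TsD.
pose y : weak_lp w p1 := t^-1 *: e s.
have yE r : y r = t^-1 * (r == s)%:R by [].
have TyE r : T y r = t^-1 * T (e s) r by rewrite linearZ.
have dxy : disjoint_supp x y.
  by move=> r; have [->|/negbTE rs] := eqVneq r s; [left|right; rewrite yE rs mulr0].
have dTxy : disjoint_supp (T x) (T y).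
  move=> r; have [|Txr] := eqVneq (T x r) 0; [by left|right].
  by rewrite TyE TsD ?mulr0//; right.
exists (x + y); split.
- move=> r D0r; rewrite -[LHS]/(x r + y r) xD0// add0r yE.
  by case: eqP D0r => [->//|_]; rewrite mulr0.
- apply: (le_normD_disjoint dxy) => // r.
  rewrite yE; case: eqP => _; rewrite ?mulr1 ?mulr0 ?normr0 ?gtr0_norm ?invr_gt0//.
  by rewrite invr_ge0 ltW.
- rewrite -natr1 mulrDl mul1r; apply: (wmass_suppD (y := y) xv); rewrite -(wB _ Bs).
  apply: le_trans (wmass_supp_indic w s); apply: le_wmass => r; rewrite /mkset.
  by rewrite yE; apply: contra => /eqP ->; rewrite mulr0.
- move=> r Dr; rewrite linearD -[LHS]/(T x r + T y r) TxD// TyE.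
  by rewrite TsD ?mulr0 ?addr0//; left.
- rewrite linearD -natr1 mulrDl mul1r; apply: (wmass_levelD _ dTxy Txm) => //.
  apply: le_trans (TB _ Bs) _; apply: le_wmass => r; rewrite /mkset.
  by rewrite TyE normrM gtr0_norm ?invr_gt0// mulrC ltr_pdivlMr// mul1r.
Qed.

Definition arbitrarily_low (kappa : R) := forall eps : R, 0 < eps ->
  exists t v B, t <= eps /\ charged kappa v t B.

(** A vector made of r blocks at heights at most eps.  In the induction a block
    of height t <= eps is added to a vector x stacked below t / 2.  Since
    (t/2)^p <= t^p / 2, the mass of the whole support is at most
    2 L t^p + 2 L t^p.  Below the level 1/t this controls the superlevel sets,
    and above it the new block, bounded by 1/t, does not contribute. *)
Lemma stacked_blocks kappa r eps : 0 < kappa -> arbitrarily_low kappa -> 0 < eps ->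
  exists2 L0, 0 < L0 & forall L, L0 <= L -> forall (D0 : set S) (D : set S'),
    countable D0 -> countable D ->
  exists x : weak_lp w p1, [/\ forall s, D0 s -> x s = 0,
    forall s', D s' -> T x s' = 0,
    (wmass w [set s | (x s != 0)%R] <= (4 * L * eps `^ p)%:E)%E,
    weak_bound p w (4 * L) x &
    ((r%:R * (kappa * L))%:E <= wmass w' [set s' | (1 < `|T x s'|)%R])%E].
Proof.
move=> k0 low; elim: r eps => [|r IH] eps eps0.
  exists 1 => // L L1 D0 D _ _; have L0 : 0 < L by apply: lt_le_trans L1.
  exists 0; rewrite linear0 mul0r; split=> //.
  - rewrite (_ : [set _ | _] = set0) ?wmass0; last first.
      by apply/seteqP; split=> s //=; rewrite eqxx.
    by rewrite lee_fin !mulr_ge0 ?powR_ge0// ltW.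
  - move=> t t0; rewrite (_ : [set _ | _] = set0) ?wmass0.
      by rewrite lee_fin divr_ge0 ?powR_ge0// mulr_ge0// ltW.
    by apply/seteqP; split=> s //=; rewrite normr0 ltNge ltW.
  - exact: wmass_ge0.
have [t [v [B [te chB]]]] := low _ eps0; have [ncB v0 t0 wB TB] := chB.
have tp0 : 0 < t `^ p by exact: powR_gt0.
have [L0 L00 LP] := IH (t / 2) (divr_gt0 t0 (ltr0n _ 2)).
exists (Num.max L0 (v / t `^ p)); first by rewrite lt_max L00.
move=> L; rewrite ge_max => /andP[/LP{}LP vL] D0 D cD0 cD.
have Lp : 0 < L by apply: lt_le_trans vL; exact: divr_gt0.
have [x [xD0 TxD xm xL Txm]] := LP _ _ cD0 cD.
(* N v / t^p lies between L and 2 L *)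
pose N := (Num.trunc (L * t `^ p / v)).+1.
have N1 : L <= N%:R * v / t `^ p.
  by rewrite ler_pdivlMr// -ler_pdivrMr// ltW// truncnS_gt.
have N2 : N%:R * v <= 2 * L * t `^ p.
  have n1 : (Num.trunc (L * t `^ p / v))%:R * v <= L * t `^ p.
    by rewrite -ler_pdivlMr// truncn_le// divr_ge0 ?mulr_ge0// ltW.
  have n2 : v <= L * t `^ p by rewrite -ler_pdivrMr.
  have aux (a u m : R) : a <= m -> u <= m -> a + u <= 2 * m by move=> *; lra.
  by rewrite /N -natr1 mulrDl mul1r -(mulrA 2); exact: aux.
have [y [yD0 yt ym TyD Tym]] := homogeneous_block N k0 chB
  (countableU cD0 (countable_supp x w_ge1)) (countableU cD (countable_supp (T x) w'_ge1)).
have dxy : disjoint_supp x y.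
  move=> s; have [|xs] := eqVneq (x s) 0; [by left|right].
  by apply: yD0; right.
have dTxy : disjoint_supp (T x) (T y).
  move=> s; have [|xs] := eqVneq (T x s) 0; [by left|right].
  by apply: TyD; right.
have half : (t / 2) `^ p <= t `^ p / 2.
  rewrite powRM ?invr_ge0 ?(ltW t0)// ler_pM2l//.
  by apply: ge1r_powR; rewrite ?(ltW p1)// invr_gt0 ltr0n/= invf_le1// ler1n.
have zm : (wmass w [set s | (x s + y s != 0)%R] <= (4 * L * t `^ p)%:E)%E.
  apply: le_trans (wmass_suppD xm ym) _; rewrite lee_fin.
  have aux (Q q n : R) : q <= Q / 2 -> n <= 2 * L * Q -> 4 * L * q + n <= 4 * L * Q.
    by move=> qQ nQ; nra.
  exact: aux.
exists (x + y); split.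
- move=> s D0s; rewrite -[LHS]/(x s + y s) xD0// yD0 ?addr0//; by left.
- move=> s Ds; rewrite linearD -[LHS]/(T x s + T y s) TxD// TyD ?addr0//; by left.
- apply: le_trans zm _; rewrite lee_fin ler_wpM2l ?mulr_ge0 ?(ltW Lp)//.
  by apply: ge0_ler_powR; rewrite ?nnegrE ?(ltW t0) ?(ltW p0) ?(ltW eps0).
- move=> u u0; have [ut|tu] := ltP u t^-1.
    apply: le_trans (le_trans zm _).
      by apply: le_wmass => s; rewrite /mkset -normr_gt0; exact: lt_trans.
    rewrite lee_fin ler_wpM2l ?mulr_ge0 ?(ltW Lp)// -powRV ?(ltW u0)//.
    apply: ge0_ler_powR; rewrite ?nnegrE ?invr_ge0 ?(ltW t0) ?(ltW p0) ?(ltW u0)//.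
    by rewrite -[leLHS]invrK lef_pV2 ?posrE ?invr_gt0// ltW.
  apply: le_trans (xL _ u0); apply: le_wmass => s; rewrite /mkset.
  rewrite -[_ s]/(x s + y s); case: (dxy s) => ->; rewrite ?addr0// add0r.
  by rewrite ltNge (le_trans (yt s))// normr0 ltNge (ltW u0).
- rewrite linearD; apply: (@le_trans _ _
    (r%:R * (kappa * L) + N%:R * (kappa * v / t `^ p))%:E); last first.
    exact: (wmass_levelD _ dTxy Txm Tym).
  rewrite lee_fin -natr1 mulrDl mul1r lerD2l// -mulrA mulrCA ler_pM2l// mulrA.
  exact: N1.
Qed.

(** Stacking r blocks costs a bounded norm 4 L, but the norm of the image grows
    linearly in r (both to the power p). *)
Lemma not_arbitrarily_low kappa : 0 < kappa -> ~ arbitrarily_low kappa.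
Proof.
move=> k0 low; pose r := (Num.trunc (4 * C / kappa)).+1.
have [L L0 /(_ L (lexx L) _ _ (countable0 _) (countable0 _))] :=
  @stacked_blocks kappa r 1 k0 low ltr01.
move=> [x [_ _ _ xL Txr]].
have L40 : 0 < 4 * L by exact: mulr_gt0.
have := le_trans Txr (TC L40 xL ltr01); apply/negP; rewrite -ltNge.
rewrite lte_fin powR1 divr1 mulrCA mulrA [ltRHS]mulrA ltr_pM2r//.
by rewrite -ltr_pdivrMr// truncnS_gt.
Qed.

Lemma countable_high_images : exists2 H : R, 0 < H & forall v B, 0 < v ->
  (forall s, B s -> (w s)%:num = v) ->
  (forall s s', B s -> T (e s) s' != 0 -> H * v <= (w' s')%:num) ->
  countable B.
Proof.
apply: contrapT => h.
have kap0 : 0 < height_const by rewrite invr_gt0 !mulr_gt0 ?powR_gt0.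
apply: (not_arbitrarily_low kap0) => eps eps0.
have H0 : 0 < C / eps `^ p by rewrite divr_gt0 ?powR_gt0.
apply: contrapT => nlow; apply: h; exists (C / eps `^ p) => // v B v0 wB HB.
apply: contrapT => ncB; apply: nlow.
have [t [B' [chB tH]]] := charged_subset v0 H0 ncB wB HB.
exists t, v, B'; split=> //; have [_ _ t0 _ _] := chB.
move: tH; rewrite invfM invrK mulrA divff ?gt_eqF// mul1r; apply: contraTT.
rewrite -!ltNge => et; apply: gt0_ltr_powR; rewrite ?nnegrE ?ltW//.
Qed.
End embeddings.

(** * Isomorphisms by rearrangement *)

Section reindexing.
Context {R : realType} (p : R) (p1 : 1 < p).

Lemma wmass_image (S S' : choiceType) (w : S -> {posnum R}) (w' : S' -> {posnum R})
    (h : S -> S') (K : R) (A : set S) : 0 <= K -> injective h ->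
  (forall s, (w' (h s))%:num <= K * (w s)%:num) ->
  (wmass w' (h @` A) <= K%:E * wmass w A)%E.
Proof.
move=> K0 hinj wh; rewrite /wmass esum_image; last by move=> x y _ _ /hinj.
apply: (@le_trans _ _ (\esum_(s in A) (K%:E * ((w s)%:num)%:E)%E)%E).
  by apply: le_esum => s _; rewrite -EFinM lee_fin.
apply: ge_ereal_sup => _ [X [finX XA] <-].
rewrite -ge0_mule_fsumr; last by move=> s; rewrite lee_fin.
rewrite lee_wpmul2l ?lee_fin//; apply: esum_ge; by exists X.
Qed.

Lemma weak_bound_reindex (S S' : choiceType) (w : S -> {posnum R})
    (w' : S' -> {posnum R}) (h : S -> S') (h' : S' -> S) (C : R) :
  cancel h h' -> cancel h' h -> 0 <= C ->
  (forall s, (w' (h s))%:num <= C * (w s)%:num) ->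
  forall (x : S -> R) K, weak_bound p w K x -> weak_bound p w' (C * K) (x \o h').
Proof.
move=> hK h'K C0 wh x K xK t t0.
rewrite (_ : [set _ | _] = h @` [set s | t < `|x s|]); last first.
  apply/seteqP; split=> [s' xs'|_ [s xs <-]] /=; last by rewrite hK.
  by exists (h' s') => //; rewrite h'K.
apply: le_trans (wmass_image _ C0 (can_inj hK) wh) _.
by rewrite -mulrA EFinM lee_wpmul2l ?lee_fin//; exact: xK.
Qed.

Lemma reindex_operator (S S' : choiceType) (w : S -> {posnum R})
    (w' : S' -> {posnum R}) (h : S -> S') (h' : S' -> S) (C : R) :
  cancel h h' -> cancel h' h -> 0 < C ->
  (forall s, (w' (h s))%:num <= C * (w s)%:num) ->
  exists2 f : {linear weak_lp w p1 -> weak_lp w' p1},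
    continuous f & forall x s', f x s' = x (h' s').
Proof.
move=> hK h'K C0 wh; have bnd := weak_bound_reindex hK h'K (ltW C0) wh.
have fP (x : weak_lp w p1) : (x : S -> R) \o h' \in wlp_pred p w'.
  have [K K0 xK] := weak_lp_weak_bound x.
  by apply: (weak_bound_pred p1 _ (bnd _ _ xK)); rewrite mulr_ge0// ltW.
pose f (x : weak_lp w p1) : weak_lp w' p1 := WeakLp p1 (fP x).
have lf : linear f by move=> a x y; apply/val_inj/funext.
pose F : {linear weak_lp w p1 -> weak_lp w' p1} :=
  HB.pack_for {linear weak_lp w p1 -> weak_lp w' p1} f
    (GRing.isLinear.Build _ _ _ _ _ lf).
by exists F => //; apply: (bounded_continuous C0) => x K _; exact: bnd.
Qed.

Lemma isomorphic_reindex (S S' : choiceType) (w : S -> {posnum R})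
    (w' : S' -> {posnum R}) (h : S -> S') (h' : S' -> S) (C : R) :
  cancel h h' -> cancel h' h -> 0 < C ->
  (forall s, (w' (h s))%:num <= C * (w s)%:num) ->
  (forall s, (w s)%:num <= C * (w' (h s))%:num) ->
  isomorphic (weak_lp w p1) (weak_lp w' p1).
Proof.
move=> hK h'K C0 wh wh'.
have [f cf fE] := reindex_operator hK h'K C0 wh.
have [|g cg gE] := reindex_operator h'K hK C0 (w := w') (w' := w).
  by move=> s'; rewrite -{2}(h'K s').
by exists f, g; split=> // x; apply/val_inj/funext => s;
  rewrite [LHS]/= ?gE ?fE ?gE ?hK ?h'K.
Qed.
End reindexing.

(** * Comparison of the levels *)

Section dyadic.
Context {R : realType} {T : choiceType} (Gam : nat -> set T).

Lemma dyadic_weightE n (s : set_type (\bigcup_n Gam n)) : trivIset setT Gam ->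
  Gam n (val s) -> (dyadic_weight R s)%:num = 2 ^+ n :> R.
Proof.
move=> tG ns; rewrite /dyadic_weight /=; congr (_ ^+ _).
case: xgetP => [m -> /= ms|/(_ n)//]; apply: tG => //; by exists (val s).
Qed.

Lemma dyadic_weight_ge1 (s : set_type (\bigcup_n Gam n)) :
  1 <= (dyadic_weight R s)%:num.
Proof. by rewrite /= exprn_ege1// ler1n. Qed.
End dyadic.

Lemma exists_linear_inverse (R : realType) (E F : preTopologicalLmodType R)
    (f : {linear E -> F}) (g : F -> E) : cancel f g -> cancel g f ->
  exists h : {linear F -> E}, h = g :> (F -> E).
Proof.
move=> fg gf; have lg : linear g := can2_linear fg gf.
by exists (HB.pack_for {linear F -> E} g (GRing.isLinear.Build _ _ _ _ _ lg)).
Qed.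

Lemma isomorphic_sym (R : realType) (E F : preTopologicalLmodType R) :
  isomorphic E F -> isomorphic F E.
Proof.
move=> [f [g [fg gf cf cg]]].
by have [h hg] := exists_linear_inverse fg gf; exists h, f; rewrite hg.
Qed.

(** An atom of Pi_n either has an image vanishing on all levels of Delta up to
    n + k, which happens for countably many atoms only, or it is seen by one of
    the atoms of these levels, each of which sees countably many. *)
Lemma card_le_of_isomorphic (R : realType) (p : R) (p1 : 1 < p) (T U : choiceType)
    (Pi : nat -> set T) (Delta : nat -> set U) :
  trivIset setT Pi -> trivIset setT Delta ->
  (forall n, Delta n #<= Delta n.+1) -> (exists m, infinite_set (Delta m)) ->
  isomorphic (E_space p1 Pi) (E_space p1 Delta) ->
  exists k, forall n, Pi n #<= Delta (n + k)%N.
Proof.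
move=> tPi tDelta mono [m infm] [f [g [fg gf cf cg]]].
pose w := @dyadic_weight R T Pi; pose w' := @dyadic_weight R U Delta.
have [gl glE] := exists_linear_inverse fg gf.
have [C C0 fC] := @continuous_bounded R _ _ p p1 w w' f cf.
have [c c0 gc] := @continuous_bounded R _ _ p p1 w' w gl
  (eq_ind_r (fun u => continuous u) cg glE).
have low (x : weak_lp w p1) K : 0 < K ->
    weak_bound p w' K (f x) -> weak_bound p w (c * K) x.
  by move=> K0 /(gc _ _ K0); rewrite glE fg.
have w1 : forall s, 1 <= (w s)%:num by exact: dyadic_weight_ge1.
have w'1 : forall s, 1 <= (w' s)%:num by exact: dyadic_weight_ge1.
have [H H0 HP] := @countable_high_images R _ _ p p1 w w' w1 w'1 f C c C0 c0 fC low.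
(* 2^k >= H, and Delta (n + k) is infinite *)
pose k := (m + (Num.trunc H).+1)%N; exists k => n.
have Hk : H <= 2 ^+ k.
  apply: (@le_trans _ _ (Num.trunc H).+1%:R); first exact/ltW/truncnS_gt.
  rewrite -natrX ler_nat; apply: leq_trans (ltnW (ltn_expl _ (ltnSn 1))) _.
  by rewrite leq_exp2l// leq_addl.
have hom := card_le_homo mono.
have infnk : infinite_set (Delta (n + k)%N).
  move/infiniteP: infm => /card_le_trans infm; apply/infiniteP/infm/hom.
  by rewrite /k addnCA leq_addr.
pose e := unit_vec p1 w.
pose B := [set s | Pi n (val s) /\
  forall s', (w' s')%:num <= 2 ^+ (n + k) -> f (e s) s' = 0].
have cB : countable B.
  apply: (HP (2 ^+ n)) => [|s [ns _]|s s' [_ fs0] fs']; first exact: exprn_gt0.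
    exact: dyadic_weightE.
  apply: (@le_trans _ _ (2 ^+ (n + k))).
    by rewrite exprD mulrC ler_wpM2l// exprn_ge0.
  by apply: ltW; rewrite ltNge; apply: contraNN fs' => /fs0 ->.
apply: card_le_trans (card_le_bigcup_levels mono infnk).
(* the countable set B goes into every fibre *)
pose F d : set T := [set val s | s in B `|` \bigcup_(s' in [set s' | val s' = d])
  [set s | (w s)%:num = 2 ^+ n /\ f (e s) s' != 0]].
apply: (@card_le_bigcup_countable _ _ _ F).
- apply: sub_infinite_set infnk => d; by exists (n + k)%N => //=.
- move=> d _; apply: sub_countable (card_image_le _ _) _; apply: countableU => //.
  apply: bigcup_countable => [|s' _].
    apply/countable_injP; exists (fun=> 0%N) => s s' /set_mem sd /set_mem s'd _.
    by apply: val_inj; rewrite sd s'd.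
  apply: (@coordinate_countable R _ _ p p1 w w' w1 f C C0 fC); exact: exprn_gt0.
- move=> x nx.
  have Px : (\bigcup_n Pi n) x by exists n.
  pose s : set_type (\bigcup_n Pi n) := SigSub (mem_set Px).
  have [/= h|/existsNP[s' /not_implyP[ws' fs']]] :=
      pselect (forall s', (w' s')%:num <= 2 ^+ (n + k) -> f (e s) s' = 0).
    have [d Dd] := infinite_setN0 infnk.
    by exists d; [exists (n + k)%N => //=|exists s => //; left].
  have [j _ js'] := set_valP s'; exists (val s').
    exists j => //=; move: ws'; rewrite (dyadic_weightE tDelta js').
    by rewrite ler_eXn2l// ltr1n.
  exists s => //; right; exists s' => //; split; last exact/eqP.
  exact: dyadic_weightE.
Qed.

(** The bounds |Delta_(n+k)| <= |Pi_(n+2k)| do not reach Delta_n for n < k.  So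
    the levels of Delta up to M, where Delta_M is infinite and M >= k, are merged
    into one level before mapping Delta to Pi. *)
Lemma isomorphic_of_card_le (R : realType) (p : R) (p1 : 1 < p) (T U : choiceType)
    (Pi : nat -> set T) (Delta : nat -> set U) (k : nat) :
  trivIset setT Pi -> trivIset setT Delta ->
  (forall n, Delta n #<= Delta n.+1) -> (exists m, infinite_set (Delta m)) ->
  (forall n, Pi n #<= Delta (n + k)%N) ->
  (forall n, Delta (n + k)%N #<= Pi (n + 2 * k)%N) ->
  isomorphic (E_space p1 Pi) (E_space p1 Delta).
Proof.
move=> tPi tDelta mono [m infm] PD DP; have hom := card_le_homo mono.
pose M := (m + k)%N.
have infM : infinite_set (Delta M).
  by move/infiniteP: infm => /card_le_trans infm; apply/infiniteP/infm/hom/leq_addr.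
pose Delta' j := if j is 0%N then \bigcup_(i in [set i | (i <= M)%N]) Delta i
                 else Delta (M + j)%N.
have D'P j : Delta' j #<= Pi (M + k + j)%N.
  have DPM i : Delta (M + i)%N #<= Pi (M + k + i)%N.
    have := DP (m + i)%N.
    by rewrite /M -!addnA mul2n -addnn (addnC i k) (addnC i) !addnA.
  case: j => [|j]; last exact: DPM.
  apply: card_le_trans (card_le_bigcup_levels mono infM) _.
  by have := DPM 0%N; rewrite !addn0.
have D'U : \bigcup_n Delta n `<=` \bigcup_n Delta' n.
  move=> x [i _ ix]; have [iM|Mi] := leqP i M; first by exists 0%N => //; exists i.
  exists (i - M)%N => //; move: ix; rewrite -{1}(subnKC (ltnW Mi)).
  by case: (i - M)%N => [|j] //; rewrite addn0; exists M => /=.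
have [d Dd] := infinite_setN0 infM.
have [t Pt] : Pi (M + k + 0)%N !=set0.
  apply/set0P/eqP => P0; have := D'P 0%N; rewrite P0 => /card_le0P D0.
  by have : Delta' 0%N d by [exists M => /=]; rewrite D0.
have [f finj fP] := level_injection (@subset_refl _ (\bigcup_n Pi n)) (inhabits d)
  (@addIn k) tDelta PD.
have [g ginj gP] := level_injection D'U (inhabits t) (@addnI (M + k)) tPi D'P.
have [h [h' [hK h'K hfg]]] := Cantor_Bernstein_graph finj ginj.
pose w := @dyadic_weight R T Pi; pose w' := @dyadic_weight R U Delta.
have C0 : 0 < 2 ^+ (M + k) :> R by exact: exprn_gt0.
have le2 i j : (i <= j)%N -> 2 ^+ i <= 2 ^+ j :> R by move=> ij; rewrite ler_eXn2l// ltr1n.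
have fw s : (w' (f s))%:num <= 2 ^+ (M + k) * (w s)%:num :> R /\
            (w s)%:num <= 2 ^+ (M + k) * (w' (f s))%:num :> R.
  have [n [ns nfs]] := fP s.
  rewrite (dyadic_weightE tPi ns) (dyadic_weightE tDelta nfs) -!exprD.
  by split; apply: le2; lia.
have gw s' : (w' s')%:num <= 2 ^+ (M + k) * (w (g s'))%:num :> R /\
             (w (g s'))%:num <= 2 ^+ (M + k) * (w' s')%:num :> R.
  have [j [js' ngs']] := gP s'; rewrite (dyadic_weightE tPi ngs').
  case: j js' {ngs'} => [[i /= iM is']|j /= js'].
    by rewrite (dyadic_weightE tDelta is') -!exprD; split; apply: le2; lia.
  by rewrite (dyadic_weightE tDelta js') -!exprD; split; apply: le2; lia.
apply: (isomorphic_reindex p1 hK h'K C0) => s.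
  by case: (hfg s) => [->|gh]; [exact: (fw s).1|rewrite -{2}gh; exact: (gw _).1].
by case: (hfg s) => [->|gh]; [exact: (fw s).2|rewrite -{1}gh; exact: (gw _).2].
Qed.

Theorem theorem24 (R : realType) (p : R) (p1 : 1 < p)
    (X : Type) (Gamma : set X) (hGamma : ~ countable Gamma)
    (T U : choiceType) (Pi : nat -> set T) (Delta : nat -> set U)
    (hPi : admissible Gamma Pi) (hDelta : admissible Gamma Delta) :
  isomorphic (E_space p1 Pi) (E_space p1 Delta) <->
  exists k : nat, (0 < k)%N /\
    forall n : nat,
      (Pi n #<= Delta (n + k)%N) /\ (Delta (n + k)%N #<= Pi (n + 2 * k)%N).
Proof.
have [tPi monoPi _ supPi] := hPi; have [tDelta monoD _ supD] := hDelta.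
have infPi := exists_infinite_level hGamma supPi.
have infD := exists_infinite_level hGamma supD.
split=> [iso|[k [_ PDP]]]; last first.
  by apply: (@isomorphic_of_card_le _ _ _ _ _ _ _ k) => // n; case: (PDP n).
have [k1 PD] := card_le_of_isomorphic tPi tDelta monoD infD iso.
have [k2 DP] := card_le_of_isomorphic tDelta tPi monoPi infPi (isomorphic_sym iso).
exists (maxn k1 k2).+1; split=> // n; split.
  by apply: card_le_trans (PD n) (card_le_homo monoD _); lia.
by apply: card_le_trans (DP _) (card_le_homo monoPi _); lia.
Qed.
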